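(* Let $k\ge2$. The code $C=\Phi_R(\mathcal{S}_k^{\beta})$ over $\mathbb{F}_q$ has length $q^{(s-1)k}\frac{q^k-1}{q-1}$, has $q^{sk}$ codewords, and has minimum Hamming distance $q^{sk-k-1}(q^k-1)$. Moreover its Hamming weight enumerator is $W_C(X,Y)=\sum_{\ell}A_\ell X^{n'-\ell}Y^\ell$, where $n'=q^{(s-1)k}\frac{q^k-1}{q-1}$ and $A_\ell=1$ if $\ell=0$; $A_\ell=q^k-1$ if $\ell=q^{sk-1}$; $A_\ell=q^{sk}-q^k$ if $\ell=q^{sk-k-1}(q^k-1)$; and $A_\ell=0$ otherwise.
   Context: Let $R$ be a finite commutative chain ring: a finite commutative ring with $1\neq0$ whose ideals form a single chain under inclusion. Its unique maximal ideal is principal, generated by some $\gamma$; let $s\ge1$ be the least integer with $\gamma^s=0$. The residue field $R/\langle\gamma\rangle$ is isomorphic to $\mathbb{F}_q$, $q$ a prime power, and $\bar r$ denotes the image of $r$. Fix coset representatives $T=\{e_0,\dots,e_{q-1}\}$ of $R/\langle\gamma\rangle$ with $e_0=0,e_1=1$, ordered $e_0<\dots<e_{q-1}$. Every $r\in R$ has a unique $\gamma$-adic representation $r=\sum_{i=0}^{s-1}r_i\gamma^i$, $r_i\in T$. Order $R$ by: $x>y$ iff $x_i>y_i$ in $T$ for the largest $i$ with $x_i\neq y_i$. List $R=\{\rho_0,\dots,\rho_{q^s-1}\}$ increasingly. For $a\in R$, $\mathbf{a}^{(m)}$ is the constant vector of length $m$. Define $G_1^\alpha=(\rho_0\ \cdots\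 \rho_{q^s-1})$ and, for $k>1$, $G_k^\alpha$ as the matrix of $q^s$ column blocks, the $j$-th having first row $\boldsymbol{\rho_j}^{(q^{s(k-1)})}$ and a copy of $G_{k-1}^\alpha$ below. Write the elements of the ideal $\langle\gamma\rangle$ in increasing order as $a_0\gamma<a_1\gamma<\dots<a_{q^{s-1}-1}\gamma$ (so $a_0\gamma=0$). Define $G_1^\beta=(1)$ and, for $k>1$, $G_k^\beta$ as the matrix with column blocks: first a block with first row $\mathbf{1}^{(q^{s(k-1)})}$ and $G_{k-1}^\alpha$ below; then, for each $j=0,\dots,q^{s-1}-1$, a block with first row the constant vector with entry $a_j\gamma$ and $G_{k-1}^\beta$ below. $\mathcal{S}_k^\beta$ is the $R$-submodule generated by the rows of $G_k^\beta$. Gray map: let $M$ be the $s\times q^{s-1}$ matrix over $\mathbb{F}_q$ (a generator matrix of the first order $q$-ary Reed–Muller code of length $q^{s-1}$) whose columns are exactly the vectors $(v,1)^T$, $v\in\mathbb{F}_q^{s-1}$; $\Phi_R(r)=(\bar r_0,\dots,\bar r_{s-1})M$, extended coordinatewise to $R^n$. The Hamming weight enumerator of a code $C$ of length $n$ is $\sum_iA_iX^{n-i}Y^i$ with $A_i$ the number of codewords of Hamming weight $i$.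
   Formalization: The nilpotency index is assumed to satisfy s ≥ 2; for s = 1 (R a field) the claimed minimum distance q^{sk-k-1}(q^k-1) = (q^k-1)/q is not an integer, so the statement fails there. *)

(* Defs.v *)
From mathcomp Require Import all_boot all_order all_algebra.
Set Implicit Arguments.
Unset Strict Implicit.
Unset Printing Implicit Defensive.
Import GRing.Theory.
Local Open Scope ring_scope.

Section ChainRing.
Variable R : finComNzRingType.

Definition is_ideal (I : {set R}) : Prop :=
  0 \in I /\ (forall x y, x \in I -> y \in I -> x + y \in I) /\
  (forall r x, x \in I -> r * x \in I).

Definition chain_ring : Prop :=
  forall I J : {set R}, is_ideal I -> is_ideal J -> I \subset J \/ J \subset I.

Definition in_pideal (gam x : R) : bool := [exists y : R, x == y * gam].
End ChainRing.

Section Construction.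
Variables (R : finComNzRingType) (F : finFieldType) (pi : R -> F).
Variables (gam : R) (s : nat) (e : 'I_#|F| -> R).
Variable (M : 'M[F]_(s, #|F| ^ (s - 1))).

Local Notation q := #|F|.

(* the gamma-adic digits of r : the unique d with r = sum_i e_(d i) gam^i *)
Definition digits (r : R) : option {ffun 'I_s -> 'I_q} :=
  [pick d : {ffun 'I_s -> 'I_q} | r == \sum_(i < s) e (d i) * gam ^+ i].

(* index in T (ordering e_0 < ... < e_(q-1)) of the i-th digit *)
Definition digit_idx (r : R) (i : 'I_s) : nat :=
  if digits r is Some d then val (d i) else 0%N.

Definition digit (r : R) (i : 'I_s) : R :=
  if digits r is Some d then e (d i) else 0.

Definition ltR (x y : R) : bool :=
  [exists i : 'I_s, (digit_idx x i < digit_idx y i)%N &&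
     [forall j : 'I_s, (i < j)%N ==> (digit_idx x j == digit_idx y j)]].
Definition leR (x y : R) : bool := (x == y) || ltR x y.

Definition rhos : seq R := sort leR (enum R).

Definition gam_list : seq R := [seq x <- rhos | in_pideal gam x].

(* generator matrices, as lists of rows *)
Fixpoint GA (k : nat) : seq (seq R) :=
  match k with
  | 0 => [::]
  | 1 => [:: rhos]
  | k'.+1 =>
      flatten [seq nseq (q ^ (s * k')) rho | rho <- rhos]
        :: [seq flatten (nseq (size rhos) r) | r <- GA k']
  end.

Fixpoint GB (k : nat) : seq (seq R) :=
  match k with
  | 0 => [::]
  | 1 => [:: [:: 1]]
  | k'.+1 =>
      (nseq (q ^ (s * k')) 1 ++
         flatten [seq nseq (size (head [::] (GB k'))) a | a <- gam_list])
        :: [seq r.1 ++ flatten (nseq (size gam_list) r.2) | r <- zip (GA k') (GB k')]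
  end.

Definition lincomb (c : seq R) (rows : seq (seq R)) : seq R :=
  [seq \sum_(i < size rows) c`_i * (nth [::] rows i)`_j
     | j <- iota 0 (size (head [::] rows))].

Definition span (rows : seq (seq R)) : seq (seq R) :=
  undup [seq lincomb (val t) rows | t : (size rows).-tuple R].

Definition SB (k : nat) : seq (seq R) := span (GB k).

Definition gray1 (r : R) : seq F :=
  [seq \sum_(i < s) pi (digit r i) * M i j | j <- enum 'I_(q ^ (s - 1))].
Definition gray (w : seq R) : seq F := flatten (map gray1 w).

Definition codeB (k : nat) : seq (seq F) := undup (map gray (SB k)).
End Construction.

Definition RM1_gen (F : finFieldType) (s : nat) (M : 'M[F]_(s, #|F| ^ (s - 1))) : Prop :=
  forall v : 'cV[F]_s,
    (exists j, col j M = v) <-> (forall i : 'I_s, i.+1 = s -> v i 0 = 1).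

Definition hamming_wt (F : finFieldType) (w : seq F) : nat := count (fun a => a != 0) w.
Definition hamming_dist (F : finFieldType) (u v : seq F) : nat :=
  count (fun p => p.1 != p.2) (zip u v).

Definition min_dist (F : finFieldType) (C : seq (seq F)) (d : nat) : Prop :=
  (exists u v, [/\ u \in C, v \in C, u != v & hamming_dist u v = d]) /\
  (forall u v, u \in C -> v \in C -> u != v -> (d <= hamming_dist u v)%N).

(* Main.v *)
Require Import Defs.
From mathcomp Require Import all_boot all_order all_algebra.
From mathcomp Require Import zify.
Set Implicit Arguments.
Unset Strict Implicit.
Unset Printing Implicit Defensive.
Import GRing.Theory.
Local Open Scope ring_scope.

(* Write [hom_wt] for the homogeneous weight of R: 0 at 0, q^(s-1) on the rest of
   the socle {x | gam x = 0}, and q^(s-2)(q-1) elsewhere.  Two elements differ by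
   a nonzero socle element iff their gamma-adic digits differ only in the last
   place, so the Gray map is an isometry from [hom_wt (x - y)] to the Hamming
   distance, and every distance in the code is the weight W(c) of the word with
   coefficient vector c.

   Every vector of R^k with a unit coordinate is u g for a unique unit u and a
   unique column g of G_k^beta.  Since [hom_wt] is invariant under units,
     q^(s-1)(q-1) W(c)
       = sum_(x in R^k) hom_wt(c.x) - sum_(x in (gam)^k) hom_wt(c.x).
   The average of [hom_wt] over each coset of the socle is q^(s-2)(q-1), hence so
   is its average over every nonzero ideal; this evaluates both sums, the second
   one being zero exactly when all coordinates of c lie in the socle. *)

(** Injectivity makes [h] a permutation of the finite type [T]; for [t = z - y] it carries the fibre
    over [y] onto the fibre over [z], so all fibres within [A] have one size. *)
Lemma card_equal_fibers (T : finType) (V : finZmodType) (A : pred T)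
    (f : T -> V) (y : V) :
  (forall t : V, exists2 h : T -> T, injective h &
     forall x, (A (h x) = A x) /\ (A x -> f (h x) = f x + t)) ->
  #|A| = (#|V| * #|[pred x | A x && (f x == y)]|)%N.
Proof.
move=> shiftP; rewrite -sum1_card (partition_big f xpredT) //=.
rewrite -sum_nat_const; apply: eq_bigr => z _.
have [h h_inj hP] := shiftP (z - y).
rewrite (reindex_inj h_inj) /= -sum1_card; apply: eq_bigl => x /=.
rewrite !unfold_in; have [-> hfx] := hP x.
case Ax: (A x) => //=; rewrite hfx //.
by rewrite addrCA -[X in _ == X]addr0 (inj_eq (addrI z)) subr_eq0.
Qed.

(** * Arithmetic of the chain ring: units, gamma-adic expansions, socle, homogeneous weight *)

Section ChainRingArithmetic.
Variables (R : finComNzRingType) (F : finFieldType) (pi : {rmorphism R -> F}).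
Variables (gam : R) (s : nat) (e : 'I_#|F| -> R).
Hypothesis pi_surj : forall y : F, exists x : R, pi x = y.
Hypothesis pi_ker : forall x : R, pi x = 0 <-> in_pideal gam x.
Hypothesis gam_s : gam ^+ s = 0.
Hypothesis gam_lt : forall i, (i < s)%N -> gam ^+ i != 0.
Hypothesis s_gt1 : (1 < s)%N.
Hypothesis e_bij : bijective (fun i => pi (e i)).
Local Notation q := #|F|.

Lemma pi0P x : pi x = 0 -> exists y, x = gam * y.
Proof. by case/pi_ker/existsP => y /eqP->; exists y; rewrite mulrC. Qed.

Lemma pi_gam y : pi (gam * y) = 0.
Proof. by apply/pi_ker/existsP; exists y; rewrite mulrC. Qed.

Lemma in_pidealE x : in_pideal gam x = (pi x == 0).
Proof. by apply/idP/eqP => /pi_ker. Qed.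

(** If [y] lifts the inverse of [pi x], then [1 - x * y] is a multiple of [gam], hence nilpotent,
    and the finite geometric series in it inverts [x * y]. *)
Lemma invertibleP x : pi x != 0 -> exists y, x * y = 1.
Proof.
move=> px0; have [y py] := pi_surj (pi x)^-1.
have /pi0P[z xyE] : pi (1 - x * y) = 0.
  by rewrite rmorphB rmorphM rmorph1 py divff // subrr.
exists (y * \sum_(i < s) (1 - x * y) ^+ i).
have := subrX1 (1 - x * y) s.
rewrite {1}xyE exprMn gam_s mul0r sub0r addrAC subrr sub0r mulNr -mulrA.
by move/oppr_inj.
Qed.

Lemma gam_unit_eq0 i u : pi u != 0 -> (gam ^+ i * u == 0) = (s <= i)%N.
Proof.
move=> /invertibleP[v uv1]; apply/eqP/idP => [gu0 | /subnKC<-].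
  rewrite leqNgt; apply/negP => /gam_lt/eqP[].
  by rewrite -[LHS]mulr1 -uv1 mulrA gu0 mul0r.
by rewrite exprD gam_s !mul0r.
Qed.

Definition gam_adic (d : {ffun 'I_s -> 'I_q}) : R :=
  \sum_(i < s) e (d i) * gam ^+ i.

Lemma pi_eB i j : (pi (e i - e j) == 0) = (i == j).
Proof.
by rewrite rmorphB subr_eq0 (inj_eq (bij_inj e_bij) i j).
Qed.

Lemma digit_ex x : exists i y, x = e i + gam * y.
Proof.
have [g _ gK] := e_bij; exists (g (pi x)).
have /pi0P[y xE] : pi (x - e (g (pi x))) = 0 by rewrite rmorphB gK subrr.
by exists y; rewrite -xE addrC subrK.
Qed.

Lemma gam_adic_surj x : exists d, x = gam_adic d.
Proof.
have [g _ _] := e_bij.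
have step m : exists (d : nat -> 'I_q) (y : R),
    x = \sum_(i < m) e (d i) * gam ^+ i + gam ^+ m * y.
  elim: m => [|m [d [y ->]]].
    by exists (fun _ => g 0), x; rewrite big_ord0 add0r mul1r.
  have [i [z ->]] := digit_ex y.
  exists (fun j => if (j < m)%N then d j else i), z.
  rewrite big_ord_recr /= ltnn mulrDr addrA exprSr mulrA [e i * _]mulrC.
  by congr (_ + _ + _); apply: eq_bigr => j _; rewrite ltn_ord.
have [d [y ->]] := step s; exists [ffun i : 'I_s => d i].
rewrite gam_s mul0r addr0; apply: eq_bigr => i _; by rewrite ffunE.
Qed.

(* The least position [i] at which two expansions differ is the valuation of
   the difference of the two elements. *)
Lemma gam_adicB (d d' : {ffun 'I_s -> 'I_q}) : d != d' ->
  exists (i : 'I_s) (u : R),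
    [/\ d i != d' i, forall j : 'I_s, (j < i)%N -> d j = d' j, pi u != 0
      & gam_adic d - gam_adic d' = gam ^+ i * u].
Proof.
move=> /eqP/ffunP neq_dd'.
have [i0 di0] : exists i, d i != d' i.
  by apply/existsP; apply/existsPn => eq_dd'; apply: neq_dd' => i; apply/eqP/negPn.
case: (@arg_minnP _ i0 (fun i => d i != d' i) val di0) => i di i_min.
have below (j : 'I_s) : (j < i)%N -> d j = d' j.
  move=> lt_ji; apply/eqP; rewrite -[_ == _]negbK.
  by apply/negP => /i_min; rewrite leqNgt lt_ji.
pose z := \sum_(j < s | j != i) (e (d j) - e (d' j)) * gam ^+ (j - i.+1).
exists i, (e (d i) - e (d' i) + gam * z); split=> //.
  by rewrite rmorphD pi_gam addr0 pi_eB.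
rewrite /gam_adic -sumrB (bigD1 i) //= -mulrBl mulrDr [_ * (e _ - _)]mulrC.
congr (_ + _); rewrite mulrA -exprSr mulr_sumr; apply: eq_bigr => j neq_ji.
have [lt_ij|] := ltnP i j.
  by rewrite mulrCA -exprD subnKC // mulrBl.
rewrite leq_eqVlt val_eqE (negPf neq_ji) /= => /below->.
by rewrite !subrr mul0r mulr0.
Qed.

Lemma gam_adic_inj : injective gam_adic.
Proof.
move=> d d' eq_dd'; apply/eqP; apply: contraT => /gam_adicB[i [u [_ _ u0]]].
by rewrite eq_dd' subrr => /esym/eqP; rewrite gam_unit_eq0 // leqNgt ltn_ord.
Qed.

Lemma digits_gam_adic d : digits gam s e (gam_adic d) = Some d.
Proof.
rewrite /digits; case: pickP => [d' /eqP/gam_adic_inj-> // | /(_ d)].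
by rewrite eqxx.
Qed.

Lemma card_chain_ring : #|R| = (q ^ s)%N.
Proof.
rewrite -[s in RHS]card_ord -[q in RHS]card_ord -card_ffun.
rewrite -(card_codom gam_adic_inj); apply: eq_card => x.
by have [d ->] := gam_adic_surj x; rewrite codom_f.
Qed.

Lemma card_pi0 : #|[pred x | pi x == 0]| = (q ^ (s - 1))%N.
Proof.
have q_gt0 : (0 < q)%N by apply/card_gt0P; exists 0.
apply/eqP; rewrite -(eqn_pmul2l q_gt0) -expnS subn1 prednK ?(ltnW s_gt1) //.
rewrite -card_chain_ring [#|R|](@card_equal_fibers _ _ predT pi 0) // => t.
have [z <-] := pi_surj t; exists (+%R^~ z); first exact: addIr.
by move=> x; rewrite rmorphD.
Qed.

(** Zero has an expansion as well; comparing it with that of [x] through [gam_adicB] gives the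
    valuation and the unit part. *)
Lemma neq0_val x : x != 0 ->
  exists i u, [/\ (i < s)%N, pi u != 0 & x = gam ^+ i * u].
Proof.
have [d0 def0] := gam_adic_surj 0; have [d ->] := gam_adic_surj x.
rewrite {1}def0 (inj_eq gam_adic_inj) => /gam_adicB[i [u [_ _ u0]]].
by rewrite -def0 subr0 => ->; exists i, u.
Qed.

Lemma socleP u : gam * u = 0 -> exists y, u = gam ^+ (s - 1) * y.
Proof.
have [-> _ | /neq0_val[i [v [lt_is v0 ->]]]] := eqVneq u 0.
  by exists 0; rewrite mulr0.
rewrite mulrA -exprS => /eqP; rewrite gam_unit_eq0 // => le_si.
by exists v; congr (gam ^+ _ * _); lia.
Qed.

(** The socle is the least nonzero ideal: [x] is a unit times [gam ^+ i] with [i < s], so it divides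
    the generator [gam ^+ (s - 1)] of the socle. *)
Lemma socle_sub_pideal x u : x != 0 -> gam * u = 0 -> exists y, u = x * y.
Proof.
move=> /neq0_val[i [v [lt_is /invertibleP[v' vv'] ->]]] /socleP[y ->].
exists (gam ^+ (s - 1 - i) * v' * y).
rewrite !mulrA -[_ * v * _]mulrA [v * _]mulrC mulrA -exprD -[_ * v * v']mulrA.
by rewrite vv' mulr1 subnKC //; lia.
Qed.

Lemma card_socle : #|[pred x | gam * x == 0]| = q.
Proof.
pose f i := gam ^+ (s - 1) * e i.
have f_inj : injective f.
  move=> i j /eqP; rewrite -subr_eq0 -mulrBr => fij.
  apply/eqP; rewrite -pi_eB; apply: contraTT fij => /gam_unit_eq0->; lia.
have gamK y : gam * (gam ^+ (s - 1) * y) = 0.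
  by rewrite mulrA -exprS subn1 prednK ?gam_s ?mul0r //; lia.
rewrite -[RHS]card_ord -(card_codom f_inj); apply: eq_card => x; rewrite !inE.
apply/eqP/codomP => [/socleP[y ->] | [i ->]]; last exact: gamK.
have [i [z ->]] := digit_ex y; exists i.
by rewrite mulrDr mulrCA gamK addr0.
Qed.

Definition hom_wt (x : R) : nat :=
  if x == 0 then 0%N
  else if gam * x == 0 then (q ^ (s - 1))%N else (q ^ (s - 2) * (q - 1))%N.

Lemma hom_wt_unit x u v : u * v = 1 -> hom_wt (u * x) = hom_wt x.
Proof.
move=> uv1; rewrite /hom_wt.
have uK y : (u * y == 0) = (y == 0).
  apply/eqP/eqP => [uy0 | ->]; last by rewrite mulr0.
  by rewrite -[y]mul1r -uv1 mulrAC uy0 mul0r.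
by rewrite uK mulrCA uK.
Qed.

Lemma card_residue_gt1 : (1 < q)%N.
Proof.
by have := max_card (pred2 (0 : F) 1); rewrite card2 eq_sym oner_neq0.
Qed.

(** If [a] is in the socle, its coset is the socle: one zero and [q - 1] elements of weight
    [q ^ (s - 1)]. Otherwise the coset misses the socle and all [q] terms are equal. *)
Lemma sum_hom_wt_socle a :
  (\sum_(u | (gam * u == 0)%R) hom_wt (a + u)%R = q * (q ^ (s - 2) * (q - 1)))%N.
Proof.
have q_gt1 := card_residue_gt1.
have [ga0 | ga0] := eqVneq (gam * a) 0.
  rewrite (reindex_inj (addrI (- a))) (bigD1 (0 : R)) /=; last first.
    by rewrite addr0 mulrN ga0 oppr0.
  rewrite /hom_wt addr0 subrr eqxx add0n.
  rewrite (eq_bigl [pred u | (gam * u == 0) && (u != 0)]); last first.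
    by move=> u; rewrite /= mulrDr mulrN ga0 oppr0 add0r.
  rewrite (eq_bigr (fun _ => q ^ (s - 1)))%N; last first.
    by move=> u /andP[/eqP gu0 /negPf u0]; rewrite addrA subrr add0r u0 gu0 eqxx.
  rewrite sum_nat_const.
  have -> : #|[pred u | (gam * u == 0) && (u != 0)]| = (q - 1)%N.
    rewrite -card_socle [in RHS](cardD1 (0 : R)) inE mulr0 eqxx add1n subn1 /=.
    by apply: eq_card => u; rewrite !inE andbC.
  rewrite mulnC mulnA; congr (_ * _)%N; rewrite -expnS.
  by congr (_ ^ _)%N; lia.
rewrite -{1}card_socle -sum_nat_const; apply: eq_big => // u /eqP gu0.
rewrite /hom_wt mulrDr gu0 addr0 (negPf ga0); case: eqP => // au0.
by case/eqP: ga0; rewrite -(mulr0 gam) -au0 mulrDr gu0 addr0.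
Qed.

(* Translating by the socle preserves the sum, and the weight has constant
   average over every coset of the socle. *)
Lemma sum_hom_wt (J : pred R) a c :
    (forall x z, J z -> J (x + z) = J x) -> (forall x z, J z -> J (z * x)) ->
    (exists2 r, J r & c * r != 0) ->
  (\sum_(r | J r) hom_wt (a + c * r)%R = #|J| * (q ^ (s - 2) * (q - 1)))%N.
Proof.
move=> JD JM [r0 Jr0 cr0]; have q_gt0 := ltnW card_residue_gt1.
apply/eqP; rewrite -(eqn_pmul2l q_gt0); apply/eqP.
transitivity (\sum_(u | (gam * u == 0)%R) \sum_(r | J r) hom_wt (a + c * r + u)%R)%N.
  rewrite -{1}card_socle -sum_nat_const; apply: eq_bigr => u /eqP.
  move=> /(socle_sub_pideal cr0)[y ->].
  (* Since [u = c * r0 * y], the shift by [u] is absorbed by translating [r] by [r0 * y], which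
     preserves [J]. *)
  rewrite (reindex_inj (addIr (r0 * y))) /=; apply: eq_big => r.
    by rewrite JD // JM.
  by rewrite mulrDr addrA mulrA.
rewrite exchange_big /= mulnCA -sum_nat_const; apply: eq_bigr => r _.
exact: sum_hom_wt_socle.
Qed.

End ChainRingArithmetic.

(** * Counting lemmas for Hamming distance *)

Lemma hamming_dist_map (F : finFieldType) (T : Type) (f g : T -> F) (l : seq T) :
  hamming_dist (map f l) (map g l) = count (fun j => f j != g j) l.
Proof. by rewrite /hamming_dist; elim: l => //= x l ->. Qed.

Lemma hamming_dist_cat (F : finFieldType) (u v u' v' : seq F) :
  size u = size v ->
  hamming_dist (u ++ u') (v ++ v') = (hamming_dist u v + hamming_dist u' v')%N.
Proof. by move=> eq_uv; rewrite /hamming_dist zip_cat // count_cat. Qed.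

Lemma count_enum (T : finType) (P : pred T) : count P (enum T) = #|P|.
Proof. by rewrite -sum1_count big_enum_cond -sum1_card. Qed.

Lemma count_diff (T : Type) (P Q : pred T) (l : seq T) : subpred P Q ->
  count (predD Q P) l = (count Q l - count P l)%N.
Proof.
move=> PQ; rewrite -(addnK (count P l) (count (predD Q P) l)); congr (_ - _)%N.
elim: l => //= x l <-; have := PQ x.
by case: (P x) => /= [->|_] //; rewrite ?add0n ?addnS ?addSn ?addnA.
Qed.

(** * Columns and weights of the first order Reed-Muller code *)

Section ReedMuller.
Variables (F : finFieldType) (s : nat) (M : 'M[F]_(s, #|F| ^ (s - 1))).
Hypothesis s_gt1 : (1 < s)%N.
Hypothesis M_RM : RM1_gen M.
Local Notation q := #|F|.

Lemma RM1_last (i : 'I_s) j : i.+1 = s -> M i j = 1.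
Proof.
move=> i_last; have /M_RM/(_ i i_last) : exists j', col j' M = col j M by exists j.
by rewrite mxE.
Qed.

(** The hyperplane of vectors with last coordinate 1, which [M_RM] makes the column set of [M]. *)
Let affine (v : 'cV[F]_s) := [forall i : 'I_s, (i.+1 == s) ==> (v i 0 == 1)].

Let affineE (l : 'I_s) : l.+1 = s -> affine =1 (fun v => v l 0 == 1).
Proof.
move=> l_last v; apply/forallP/eqP => [/(_ l) | vl1 i].
  by rewrite l_last eqxx => /eqP.
apply/implyP => /eqP i_last; suff -> : i = l by rewrite vl1.
by apply: val_inj; apply: succn_inj; rewrite i_last.
Qed.

Let affineP v : reflect (exists j, col j M = v) (affine v).
Proof.
apply: (iffP forallP) => [v1 | /M_RM v1 i].
  by apply/M_RM => i /eqP i_last; apply/eqP; apply: (implyP (v1 i)).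
by apply/implyP => /eqP/v1/eqP.
Qed.

Let card_affine : #|affine| = (q ^ (s - 1))%N.
Proof.
have lt_l : (s - 1 < s)%N by lia.
pose l := Ordinal lt_l; have l_last : l.+1 = s by rewrite /=; lia.
have q_gt0 := ltnW (card_residue_gt1 F).
apply/eqP; rewrite -(eqn_pmul2l q_gt0) -expnS.
have -> : (s - 1).+1 = (s * 1)%N by lia.
rewrite -card_mx.
rewrite [#|{: 'cV_s}|](@card_equal_fibers _ _ predT (fun v : 'cV[F]_s => v l 0) 1).
  by rewrite (eq_card (affineE l_last)).
move=> t; exists (+%R^~ (t *: delta_mx l 0)); first exact: addIr.
by move=> v; rewrite !mxE !eqxx mulr1.
Qed.

(** [M_RM] fixes only the set of columns; that set has as many elements as there are column indices,
    so no column repeats. *)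
Let col_inj : injective (fun j => col j M).
Proof.
suff /image_injP col_inj : #|[seq col j M | j in predT]| == #|'I_(q ^ (s - 1))|.
  by move=> j j'; apply: col_inj.
rewrite card_ord -[X in _ == X]card_affine; apply/eqP/eq_card => v.
apply/imageP/affineP => [[j _ ->] | [j <-]]; [by exists j | by exists j].
Qed.

(* Adding a multiple of a non-last basis vector permutes the columns and moves
   the linear form [a] through all its values equally often. *)
Lemma RM1_weight (a : 'I_s -> F) (i : 'I_s) : i.+1 != s -> a i != 0 ->
  #|[pred j | \sum_m a m * M m j != 0]| = (q ^ (s - 2) * (q - 1))%N.
Proof.
move=> i_nlast ai0; have q_gt0 := ltnW (card_residue_gt1 F).
have lt_l : (s - 1 < s)%N by lia.
pose l := Ordinal lt_l; have l_last : l.+1 = s by rewrite /=; lia.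
pose f (v : 'cV[F]_s) := \sum_m a m * v m 0.
have zeros : #|[pred j | \sum_m a m * M m j == 0]| = (q ^ (s - 2))%N.
  apply/eqP; rewrite -(eqn_pmul2l q_gt0) -expnS.
  have -> : (s - 2).+1 = (s - 1)%N by lia.
  rewrite -[X in _ == X]card_affine [#|affine|](@card_equal_fibers _ _ affine f 0).
    rewrite -(card_image col_inj); apply/eqP; congr (_ * _)%N; apply: eq_card => v.
    rewrite !inE; apply/imageP/andP => [[j fj0 ->] | [/affineP[j <-] fj0]].
      split; first by apply/affineP; exists j.
      by rewrite -(eqP fj0); apply/eqP/eq_bigr => m _; rewrite mxE.
    exists j => //; rewrite !inE; move: fj0; rewrite /f.
    by under eq_bigr do rewrite mxE.
  move=> t; exists (+%R^~ ((a i)^-1 * t *: delta_mx i 0)); first exact: addIr.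
  move=> v; split.
    rewrite !(affineE l_last) !mxE (_ : l == i = false) ?mulr0 ?addr0 //.
    by apply: contraNF i_nlast => /eqP<-; rewrite l_last.
  move=> _; rewrite /f.
  under eq_bigr do rewrite !mxE mulrDr.
  rewrite big_split; congr (_ + _); rewrite (bigD1 i) //= !eqxx mulr1 mulrA divff //.
  rewrite mul1r big1 ?addr0 // => m /negPf->.
  by rewrite !mulr0.
have := cardC [pred j | \sum_m a m * M m j == 0]; rewrite card_ord zeros => eqC.
rewrite mulnBr muln1 -expnSr.
have -> : (s - 2).+1 = (s - 1)%N by lia.
by rewrite -[X in _ = (X - _)%N]eqC addKn; apply: eq_card.
Qed.

End ReedMuller.

(** * The Gray map as an isometry *)

Section GrayMap.
Variables (R : finComNzRingType) (F : finFieldType) (pi : {rmorphism R -> F}).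
Variables (gam : R) (s : nat) (e : 'I_#|F| -> R).
Variable (M : 'M[F]_(s, #|F| ^ (s - 1))).
Hypothesis pi_surj : forall y : F, exists x : R, pi x = y.
Hypothesis pi_ker : forall x : R, pi x = 0 <-> in_pideal gam x.
Hypothesis gam_s : gam ^+ s = 0.
Hypothesis gam_lt : forall i, (i < s)%N -> gam ^+ i != 0.
Hypothesis s_gt1 : (1 < s)%N.
Hypothesis e_bij : bijective (fun i => pi (e i)).
Hypothesis e0 : forall i : 'I_#|F|, val i = 0%N -> e i = 0.
Hypothesis M_RM : RM1_gen M.
Local Notation q := #|F|.

Let digitsK := digits_gam_adic pi_surj pi_ker gam_s gam_lt e_bij.

Lemma size_gray1 x : size (gray1 pi gam e M x) = (q ^ (s - 1))%N.
Proof. by rewrite size_map -cardE card_ord. Qed.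

Lemma gray1_0 : gray1 pi gam e M 0 = nseq (q ^ (s - 1)) 0.
Proof.
have q_gt0 := ltnW (card_residue_gt1 F).
pose d : {ffun 'I_s -> 'I_q} := [ffun=> Ordinal q_gt0].
have d0 : gam_adic gam e d = 0.
  by rewrite /gam_adic big1 // => i _; rewrite ffunE e0 ?mul0r.
rewrite -(size_gray1 0); apply/all_pred1P/allP => x /mapP[j _ ->] /=.
rewrite big1 // => i _; rewrite /digit -d0 digitsK.
by rewrite ffunE e0 // rmorph0 mul0r.
Qed.

(** The images differ where the linear form with coefficients [a] is nonzero. If the digits first
    differ in the last place, that form is a nonzero constant on the columns and every position
    counts; otherwise [RM1_weight] applies. *)
Lemma hamming_dist_gray1 x y :
  hamming_dist (gray1 pi gam e M x) (gray1 pi gam e M y) = hom_wt F gam s (x - y).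
Proof.
rewrite hamming_dist_map count_enum.
have [d ->] := gam_adic_surj pi_ker gam_s e_bij x.
have [d' ->] := gam_adic_surj pi_ker gam_s e_bij y.
rewrite /digit !digitsK.
pose a m := pi (e (d m)) - pi (e (d' m)).
rewrite (@eq_card _ _ [pred j | \sum_m a m * M m j != 0]); last first.
  move=> j; rewrite !unfold_in -subr_eq0 -sumrB.
  by under eq_bigr do rewrite -mulrBl.
have [eq_dd' | ] := eqVneq d d'.
  rewrite eq_dd' subrr /hom_wt eqxx eq_card0 // => j; rewrite !inE.
  by rewrite big1 ?eqxx // => m _; rewrite /a eq_dd' subrr mul0r.
case/(gam_adicB pi_ker e_bij) => i [u [di below u0 ->]].
rewrite /hom_wt mulrA -exprS !(gam_unit_eq0 pi_surj pi_ker gam_s gam_lt) //.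
have ai0 : a i != 0 by rewrite /a -rmorphB (pi_eB e_bij).
rewrite [(s <= i)%N]leqNgt ltn_ord /=; case: ifP => [le_si | lt_is].
  have i_last : i.+1 = s by apply/eqP; rewrite eqn_leq ltn_ord le_si.
  rewrite -[RHS]card_ord; apply: eq_card => j; rewrite !inE (bigD1 i) //= big1.
    by rewrite (RM1_last M_RM) // mulr1 addr0 ai0.
  move=> m neq_mi; rewrite /a below ?subrr ?mul0r //.
  move: (ltn_ord m) neq_mi; rewrite -[m == i]val_eqE /=.
  by rewrite -[X in (_ < X)%N]i_last ltnS leq_eqVlt => /orP[->|].
by rewrite (RM1_weight s_gt1 M_RM _ ai0) //; apply: contraFN lt_is => /eqP->.
Qed.

Lemma hamming_dist_gray (T : Type) (f g : T -> R) (l : seq T) :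
  hamming_dist (gray pi gam e M (map f l)) (gray pi gam e M (map g l)) =
    (\sum_(x <- l) hom_wt F gam s (f x - g x)%R)%N.
Proof.
rewrite /gray; elim: l => [|x l IHl]; first by rewrite big_nil.
by rewrite big_cons /= hamming_dist_cat ?size_gray1 // IHl hamming_dist_gray1.
Qed.

Lemma size_gray w : size (gray pi gam e M w) = (size w * q ^ (s - 1))%N.
Proof.
by rewrite /gray; elim: w => //= x w IHw; rewrite size_cat IHw size_gray1.
Qed.

(** Weight is distance from the zero word, which [gray1_0] identifies as a Gray image. *)
Lemma hamming_wt_gray (T : Type) (f : T -> R) (l : seq T) :
  hamming_wt (gray pi gam e M (map f l)) = (\sum_(x <- l) hom_wt F gam s (f x))%N.
Proof.
have wt_dist (u : seq F) n : size u = n -> hamming_dist u (nseq n 0) = hamming_wt u.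
  by move=> <-; rewrite /hamming_dist /hamming_wt; elim: u => //= x u ->.
rewrite -[LHS](wt_dist _ (size (map f l) * q ^ (s - 1))%N) ?size_gray //.
have -> : nseq (size (map f l) * q ^ (s - 1)) 0 = gray pi gam e M (map (fun=> 0) l).
  rewrite /gray; elim: l => //= x l <-.
  by rewrite gray1_0 mulSn nseqD.
by rewrite hamming_dist_gray; apply: eq_bigr => x _; rewrite subr0.
Qed.

End GrayMap.

(** * Lists of all vectors with entries in a given list *)

Fixpoint vecs (T : Type) (L : seq T) (k : nat) : seq (seq T) :=
  if k is k'.+1 then [seq x :: g | x <- L, g <- vecs L k'] else [:: [::]].

Lemma vecsS (T : Type) (L : seq T) k :
  vecs L k.+1 = [seq x :: g | x <- L, g <- vecs L k].
Proof. by []. Qed.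

Lemma size_vecs (T : Type) (L : seq T) k : size (vecs L k) = (size L ^ k)%N.
Proof. by elim: k => //= k IHk; rewrite size_allpairs IHk expnS. Qed.

Lemma vecs_uniq (T : eqType) (L : seq T) k : uniq L -> uniq (vecs L k).
Proof.
move=> uniqL; elim: k => //= k IHk; apply: allpairs_uniq => //.
by move=> [x g] [y h] _ _ /= [-> ->].
Qed.

Lemma mem_vecs (T : eqType) (L : seq T) k g :
  (g \in vecs L k) = (size g == k) && all (mem L) g.
Proof.
elim: k g => [|k IHk] [|x g] //=; first by apply/negbTE/allpairsP => -[[y h] []].
rewrite eqSS andbCA -IHk; apply/allpairsP/andP => [[[y h] [Ly Vh [-> ->]]] | [Lx Vg]].
  by [].
by exists (x, g).
Qed.

Lemma count_all_vecs (T : Type) (P : pred T) (L : seq T) k :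
  count (all P) (vecs L k) = (count P L ^ k)%N.
Proof.
elim: k => //= k IHk; rewrite expnS -IHk.
elim: L {IHk} (vecs L k) => //= x L IHL C; rewrite count_cat IHL mulnDl count_map.
congr (_ + _)%N; elim: C => [|g C /= ->]; first by rewrite muln0.
by rewrite mulnDr mulnb.
Qed.

Lemma perm_enum_tuple (T : finType) (L : seq T) k :
  perm_eq L (enum T) -> perm_eq (map val (enum {: k.-tuple T})) (vecs L k).
Proof.
move=> permL; apply: uniq_perm.
- by rewrite (map_inj_uniq val_inj) enum_uniq.
- by apply: vecs_uniq; rewrite (perm_uniq permL) enum_uniq.
move=> g; rewrite mem_vecs; apply/mapP/andP => [[t _ ->] | [sz_g _]].
  rewrite size_tuple; split=> //; apply/allP => x _ /=.
  by rewrite (perm_mem permL) mem_enum.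
by exists (Tuple sz_g); rewrite ?mem_enum.
Qed.

(** * The generator matrices through their columns *)

Section GeneratorMatrices.
Variable R : finComNzRingType.

Definition coord_rows (C : seq (seq R)) (k : nat) : seq (seq R) :=
  [seq [seq g`_i | g <- C] | i <- iota 0 k].

(** The coefficients form a function on [nat], so that dropping the first one is composition with
    [S]. *)
Definition dot (k : nat) (c : nat -> R) (g : seq R) : R :=
  \sum_(i < k) c i * g`_i.

Lemma dot_cons k c x g : dot k.+1 c (x :: g) = c 0%N * x + dot k (c \o S) g.
Proof. by rewrite /dot big_ord_recl. Qed.

Lemma dotB k c c' g : dot k (fun i => c i - c' i) g = dot k c g - dot k c' g.
Proof. by rewrite /dot -sumrB; apply: eq_bigr => i _; rewrite mulrBl. Qed.

Lemma dotZ k c u g : dot k c (map ( *%R u) g) = u * dot k c g.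
Proof.
rewrite /dot mulr_sumr; apply: eq_bigr => i _; rewrite mulrCA.
have [lt_ig | le_gi] := ltnP i (size g); first by rewrite (nth_map 0).
by rewrite !nth_default ?size_map // !mulr0.
Qed.

Lemma coord_rowsS C k :
  coord_rows C k.+1 =
    [seq g`_0 | g <- C] :: [seq [seq g`_i.+1 | g <- C] | i <- iota 0 k].
Proof. by rewrite /coord_rows /= (iotaDl 1 0) -map_comp. Qed.

Lemma coord0_pairs (L : seq R) C :
  [seq g`_0 | g <- [seq x :: g | x <- L, g <- C]] =
    flatten [seq nseq (size C) x | x <- L].
Proof.
rewrite map_allpairs; congr flatten; apply: eq_map => x.
by elim: C => //= g C ->.
Qed.

Lemma coordS_pairs (L : seq R) C i :
  [seq g`_i.+1 | g <- [seq x :: g | x <- L, g <- C]] =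
    flatten (nseq (size L) [seq g`_i | g <- C]).
Proof. by rewrite map_allpairs; congr flatten; elim: L => //= x L ->. Qed.

Lemma lincomb_coord_rows (c : seq R) C k : (0 < k)%N ->
  lincomb c (coord_rows C k) = [seq dot k (nth 0 c) g | g <- C].
Proof.
move=> k_gt0; set rows := coord_rows C k.
(* [lincomb] reads the word length off the first row, hence the need for [0 < k]. *)
have sz_head : size (head [::] rows) = size C.
  by case: k k_gt0 @rows => // k _; rewrite /= size_map.
have sz_rows : size rows = k by rewrite size_map size_iota.
rewrite /lincomb sz_head; apply: (@eq_from_nth _ 0).
  by rewrite !size_map size_iota.
move=> j; rewrite size_map size_iota => lt_jC.
rewrite (nth_map 0%N) ?size_iota // (nth_map [::]) // nth_iota // add0n.
rewrite -(big_mkord xpredT (fun i => c`_i * (nth [::] rows i)`_j)) sz_rows.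
rewrite big_mkord; apply: eq_bigr => i _.
by rewrite (nth_map 0%N) ?size_iota ?nth_iota // (nth_map [::]).
Qed.

Lemma span_tuples (rows : seq (seq R)) n : size rows = n ->
  Defs.span rows = undup [seq lincomb c rows | c <- map val (enum {: n.-tuple R})].
Proof. by move=> <-; rewrite -map_comp. Qed.

Variables (F : finFieldType) (gam : R) (s : nat) (e : 'I_#|F| -> R).
Hypothesis card_R : #|R| = (#|F| ^ s)%N.
Local Notation rhos := (rhos gam s e).
Local Notation gam_list := (gam_list gam s e).

Lemma perm_rhos : perm_eq rhos (enum R).
Proof. by rewrite perm_sort. Qed.

Lemma sum_rhos (f : R -> nat) : (\sum_(x <- rhos) f x = \sum_x f x)%N.
Proof. by rewrite (perm_big _ perm_rhos) big_enum. Qed.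

Lemma sum_gam_list (f : R -> nat) :
  (\sum_(x <- gam_list) f x = \sum_(x | in_pideal gam x) f x)%N.
Proof. by rewrite big_filter (perm_big _ perm_rhos) big_enum_cond. Qed.

Lemma size_rhos : size rhos = (#|F| ^ s)%N.
Proof. by rewrite (perm_size perm_rhos) -cardE. Qed.

Lemma GA_rec k :
  GA gam s e k.+2 =
    flatten [seq nseq (#|F| ^ (s * k.+1)) x | x <- rhos]
      :: [seq flatten (nseq (size rhos) r) | r <- GA gam s e k.+1].
Proof. by []. Qed.

Lemma GB_rec k :
  GB gam s e k.+2 =
    (nseq (#|F| ^ (s * k.+1)) 1 ++
       flatten [seq nseq (size (head [::] (GB gam s e k.+1))) a | a <- gam_list])
      :: [seq r.1 ++ flatten (nseq (size gam_list) r.2)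
            | r <- zip (GA gam s e k.+1) (GB gam s e k.+1)].
Proof. by []. Qed.

(** In [vecs] the first coordinate varies slowest, which is exactly the block layout of the alpha
    matrix: its columns are all vectors of R^k. *)
Lemma GA_coord k : GA gam s e k = coord_rows (vecs rhos k) k.
Proof.
elim: k => [|[_|k IHk]] //.
  by rewrite coord_rowsS coord0_pairs /=; congr (_ :: _); elim: rhos => //= x l <-.
rewrite coord_rowsS vecsS coord0_pairs size_vecs size_rhos -expnM.
rewrite (eq_map (coordS_pairs rhos (vecs rhos k.+1))) GA_rec IHk.
by rewrite [coord_rows _ _ in LHS]/coord_rows -map_comp.
Qed.

(** A column has entries in the ideal, then a 1, then arbitrary entries: the normal form, up to a
    unit, of a vector with a unit coordinate. The empty vector has none, hence the empty list at
    0. *)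
Fixpoint beta_cols (k : nat) : seq (seq R) :=
  if k is k'.+1 then
    map (cons 1) (vecs rhos k') ++ [seq a :: g | a <- gam_list, g <- beta_cols k']
  else [::].

Lemma beta_colsS k :
  beta_cols k.+1 =
    map (cons 1) (vecs rhos k) ++ [seq a :: g | a <- gam_list, g <- beta_cols k].
Proof. by []. Qed.

Lemma GB_coord k : GB gam s e k = coord_rows (beta_cols k) k.
Proof.
elim: k => [|[_|k IHk]] //.
  by rewrite coord_rowsS /=; elim: gam_list.
rewrite coord_rowsS beta_colsS map_cat coord0_pairs -map_comp.
rewrite GB_rec IHk GA_coord.
congr ((_ ++ _) :: _).
- rewrite expnM -size_rhos -size_vecs.
  by elim: (vecs _ _) => //= g C ->.
- by rewrite /= size_map.
rewrite /coord_rows zip_map -map_comp; apply: eq_map => i.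
by rewrite /= -beta_colsS -vecsS map_cat coordS_pairs -map_comp.
Qed.

Lemma sum_beta_cols k (f : seq R -> nat) :
  (\sum_(g <- beta_cols k.+1) f g =
   \sum_(g <- vecs rhos k) f (1%R :: g) +
     \sum_(g <- beta_cols k) \sum_(a <- gam_list) f (a :: g))%N.
Proof.
by rewrite big_cat big_map big_allpairs_dep /= [in X in (_ + X)%N]exchange_big.
Qed.

Lemma sum_vecsS (L : seq R) k (f : seq R -> nat) :
  (\sum_(g <- vecs L k.+1) f g =
   \sum_(x <- L) \sum_(g <- vecs L k) f (x :: g))%N.
Proof. by rewrite big_allpairs_dep. Qed.

Lemma unit_mulI (u v : R) : u * v = 1 -> injective ( *%R u).
Proof.
move=> uv1; apply: (can_inj (g := *%R v)) => x.
by rewrite mulrA [v * u]mulrC uv1 mul1r.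
Qed.

Lemma sum_vecs_scale k u v (f : seq R -> nat) : u * v = 1 ->
  (\sum_(g <- vecs rhos k) f (map ( *%R u) g) = \sum_(g <- vecs rhos k) f g)%N.
Proof.
move=> uv1; elim: k f => [|k IHk] f; first by rewrite !big_seq1.
rewrite !sum_vecsS !sum_rhos [RHS](reindex_inj (unit_mulI uv1)) /=.
by apply: eq_bigr => x _; rewrite (IHk (fun g => f (u * x :: g))).
Qed.

(* Every vector with a unit coordinate is a unit multiple of exactly one column
   of the beta matrix; all the other vectors have coordinates in the ideal. *)
Lemma unimodular_sum (k : nat) (f : seq R -> nat) :
    (forall x, ~~ in_pideal gam x -> exists y, x * y = 1) ->
    (forall u v g, u * v = 1 -> f (map ( *%R u) g) = f g) ->
  (#|[pred x | ~~ in_pideal gam x]| * \sum_(g <- beta_cols k) f g +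
     \sum_(g <- vecs gam_list k) f g = \sum_(g <- vecs rhos k) f g)%N.
Proof.
move=> unitP; elim: k f => [|k IHk] f f_inv; first by rewrite big_nil muln0.
(* Both sides are split by the first coordinate. Where it lies in the ideal, the induction
   hypothesis is used for [f] summed over that coordinate. *)
rewrite sum_beta_cols !sum_vecsS [X in (_ + X)%N]exchange_big mulnDr -addnA IHk.
  rewrite [in X in (_ + X)%N]exchange_big /= sum_rhos sum_gam_list.
  rewrite [RHS](bigID (in_pideal gam)) /= addnC -sum_nat_const; congr (_ + _)%N.
  (* A unit first coordinate [x] is factored out of the whole vector; scaling by [x] permutes the
     tails, so every unit contributes the same sum. *)
  apply: eq_bigr => x /unitP[y xy1].
  rewrite -[RHS](sum_vecs_scale _ _ xy1); apply: eq_bigr => g _.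
  by rewrite -(f_inv _ _ (1 :: g) xy1) /= mulr1.
(* Side condition of [IHk]: the summed function is unit-invariant because units permute the
   ideal. *)
move=> u v g uv1; rewrite !sum_gam_list (reindex_inj (unit_mulI uv1)) /=.
apply: eq_big => x; last by rewrite -(f_inv _ _ (x :: g) uv1).
apply/existsP/existsP => [] [y /eqP xE].
  by exists (v * y); rewrite -mulrA -xE mulrA [v * u]mulrC uv1 mul1r.
by exists (u * y); rewrite xE mulrA.
Qed.

Lemma dot_eq0 (L : seq R) k c g :
    (forall i, (i < k)%N -> {in L, forall r, c i * r = 0}) ->
  g \in vecs L k -> dot k c g = 0.
Proof.
move=> cL0; rewrite mem_vecs => /andP[/eqP sz_g /allP Lg].
rewrite /dot big1 // => i _; apply: cL0 => //; apply: Lg.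
by rewrite mem_nth // sz_g.
Qed.

(** Induction on [k], with [a] general so that it absorbs the first term. If the remaining
    coefficients do not all kill [L], the inner sums are constant by induction; otherwise the tail
    contributes 0 and the first coordinate alone gives the average [N]. *)
Lemma sum_vecs_dot (L : seq R) (h : R -> nat) (N : nat) :
    (forall c a, has (fun r => c * r != 0) L ->
       (\sum_(r <- L) h (a + c * r)%R = size L * N)%N) ->
  forall k (c : nat -> R) a, [exists i : 'I_k, has (fun r => c i * r != 0) L] ->
    (\sum_(g <- vecs L k) h (a + dot k c g)%R = size L ^ k * N)%N.
Proof.
move=> hL; elim=> [|k IHk] c a cL; first by case/existsP: cL => [[]].
rewrite sum_vecsS; under eq_bigr do under eq_bigr do rewrite dot_cons addrA.
have [/IHk IH | cL'] := boolP [exists i : 'I_k, has (fun r => (c \o S) i * r != 0) L].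
  under eq_bigr do rewrite IH.
  by rewrite big_const_seq count_predT iter_addn_0 mulnC mulnA -expnS.
have c0 g : g \in vecs L k -> dot k (c \o S) g = 0.
  apply: dot_eq0 => i lt_ik r Lr; apply/eqP; apply: contraNT cL' => cr.
  by apply/existsP; exists (Ordinal lt_ik); apply/hasP; exists r.
have {}cL : has (fun r => c 0%N * r != 0) L.
  case/existsP: cL => -[[|i] lt_ik] // ciL.
  by case/existsP: cL'; exists (Ordinal (lt_ik : (i < k)%N)).
under eq_bigr => x _.
  under eq_big_seq => g /c0 -> do rewrite addr0.
  rewrite big_const_seq count_predT iter_addn_0 size_vecs; over.
by rewrite -big_distrl /= hL // mulnAC expnS.
Qed.

End GeneratorMatrices.

(** * Weights and parameters of the beta code *)

Section BetaCode.
Variables (R : finComNzRingType) (F : finFieldType) (pi : {rmorphism R -> F}).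
Variables (gam : R) (s : nat) (e : 'I_#|F| -> R).
Variable (M : 'M[F]_(s, #|F| ^ (s - 1))).
Hypothesis pi_surj : forall y : F, exists x : R, pi x = y.
Hypothesis pi_ker : forall x : R, pi x = 0 <-> in_pideal gam x.
Hypothesis gam_s : gam ^+ s = 0.
Hypothesis gam_lt : forall i, (i < s)%N -> gam ^+ i != 0.
Hypothesis s_gt1 : (1 < s)%N.
Hypothesis e_bij : bijective (fun i => pi (e i)).
Hypothesis e0 : forall i : 'I_#|F|, val i = 0%N -> e i = 0.
Hypothesis M_RM : RM1_gen M.
Variable k : nat.
Hypothesis k_gt0 : (0 < k)%N.
Local Notation q := #|F|.
Local Notation rhos := (rhos gam s e).
Local Notation gam_list := (gam_list gam s e).
Local Notation cols := (beta_cols gam s e k).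

Let q_gt1 : (1 < q)%N := card_residue_gt1 F.
Let card_R := card_chain_ring pi_surj pi_ker gam_s gam_lt e_bij.
(** With [0 < k] this keeps the truncated subtraction [s * k - k - 1] exact; [lia] sees [s * k] as
    an atom. *)
Let le_k_sk : (k + k <= s * k)%N.
Proof. by rewrite addnn -mul2n leq_mul2r s_gt1 orbT. Qed.

Let in_idealE := in_pidealE pi_ker.

Lemma size_gam_list : size gam_list = (q ^ (s - 1))%N.
Proof.
rewrite -(card_pi0 pi_surj pi_ker gam_s gam_lt s_gt1 e_bij) -!sum1_card -sum1_size.
by rewrite sum_gam_list; apply: eq_bigl => x; rewrite in_idealE.
Qed.

Lemma card_nonideal : #|[pred x | ~~ in_pideal gam x]| = (q ^ (s - 1) * (q - 1))%N.
Proof.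
have := cardC [pred x : R | pi x == 0].
rewrite (card_pi0 pi_surj pi_ker gam_s gam_lt s_gt1 e_bij) card_R => cardE.
rewrite mulnBr muln1 -expnSr subn1 prednK; last exact: ltnW.
rewrite -cardE -subn1 addKn; apply: eq_card => x.
by rewrite !inE in_idealE.
Qed.

Let beta_sum (f : seq R -> nat) :
    (forall u v g, u * v = 1 -> f (map ( *%R u) g) = f g) ->
  (q ^ (s - 1) * (q - 1) * \sum_(g <- cols) f g + \sum_(g <- vecs gam_list k) f g =
     \sum_(g <- vecs rhos k) f g)%N.
Proof.
rewrite -card_nonideal; apply: unimodular_sum => x; rewrite in_idealE.
exact: (invertibleP pi_surj pi_ker gam_s).
Qed.

(** [beta_sum] at the constant 1 counts the vectors with a unit coordinate. The quotient is handled
    by multiplying through by [q - 1], a divisor of [q ^ k - 1]. *)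
Lemma size_beta_cols :
  (size cols * q ^ (s - 1) = q ^ ((s - 1) * k) * ((q ^ k - 1) %/ (q - 1)))%N.
Proof.
have := @beta_sum (fun=> 1%N) (fun _ _ _ _ => erefl).
rewrite !sum1_size !size_vecs size_gam_list size_rhos // -!expnM => sum_eq.
have dvd_q : (q - 1 %| q ^ k - 1)%N by rewrite !subn1 predn_exp dvdn_mulr.
apply/eqP; rewrite -(@eqn_pmul2l (q - 1)%N) ?subn_gt0 //; apply/eqP.
rewrite [RHS]mulnCA [((q - 1) * (_ %/ _))%N]mulnC divnK // mulnBr muln1 -expnD.
have -> : ((s - 1) * k + k = s * k)%N by rewrite mulnBl mul1n subnK //; lia.
by rewrite -sum_eq addnK [(size cols * _)%N]mulnC mulnA [((q - 1) * _)%N]mulnC.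
Qed.

Definition cw_wt (c : nat -> R) : nat :=
  (\sum_(g <- cols) hom_wt F gam s (dot k c g))%N.

Let cw_wt_sum c :
  (q ^ (s - 1) * (q - 1) * cw_wt c +
       \sum_(g <- vecs gam_list k) hom_wt F gam s (dot k c g)
     = \sum_(g <- vecs rhos k) hom_wt F gam s (dot k c g))%N.
Proof.
apply: (beta_sum (f := fun g => hom_wt F gam s (dot k c g))) => u v g uv1.
by rewrite dotZ (hom_wt_unit _ _ _ _ uv1).
Qed.

Let mem_gam_list x : (x \in gam_list) = in_pideal gam x.
Proof. by rewrite mem_filter (perm_mem (perm_rhos gam s e)) mem_enum andbT. Qed.

Let sum_rhos_dot (c : nat -> R) : [exists i : 'I_k, c i != 0] ->
  (\sum_(g <- vecs rhos k) hom_wt F gam s (dot k c g) =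
     q ^ (s * k) * (q ^ (s - 2) * (q - 1)))%N.
Proof.
case/existsP=> i ci0.
have := @sum_vecs_dot R rhos (hom_wt F gam s) (q ^ (s - 2) * (q - 1))%N _ k c 0.
rewrite size_rhos // -expnM => <-.
- by apply: eq_bigr => g _; rewrite add0r.
- move=> d a /hasP[r _ dr0]; rewrite sum_rhos -card_R.
  apply: (sum_hom_wt pi_surj pi_ker gam_s gam_lt s_gt1 e_bij (J := predT)) => //.
  by exists r.
apply/existsP; exists i; apply/hasP; exists 1; last by rewrite mulr1.
by rewrite (perm_mem (perm_rhos gam s e)) mem_enum.
Qed.

Let sum_gam_dot (c : nat -> R) : [exists i : 'I_k, gam * c i != 0] ->
  (\sum_(g <- vecs gam_list k) hom_wt F gam s (dot k c g) =
     q ^ ((s - 1) * k) * (q ^ (s - 2) * (q - 1)))%N.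
Proof.
case/existsP=> i gci0.
have := @sum_vecs_dot R gam_list (hom_wt F gam s) (q ^ (s - 2) * (q - 1))%N _ k c 0.
rewrite size_gam_list -expnM => <-.
- by apply: eq_bigr => g _; rewrite add0r.
- move=> d a /hasP[r gr dr0]; rewrite sum_gam_list -size_gam_list.
  rewrite -sum1_size sum_gam_list sum1_card.
  apply: (sum_hom_wt pi_surj pi_ker gam_s gam_lt s_gt1 e_bij) => [x z|x z|].
  + by rewrite !in_idealE rmorphD => /eqP->; rewrite addr0.
  + by rewrite !in_idealE rmorphM => /eqP->; rewrite mul0r.
  by exists r; rewrite -?mem_gam_list.
(* [gam] itself is the element of the ideal that [c i] does not kill. *)
apply/existsP; exists i; apply/hasP; exists gam; last by rewrite mulrC.
by rewrite mem_gam_list; apply/existsP; exists 1; rewrite mul1r.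
Qed.

Local Notation soc_wt := (q ^ (s * k - 1))%N.
Local Notation gen_wt := (q ^ (s * k - k - 1) * (q ^ k - 1))%N.

Lemma cw_wtE (c : nat -> R) :
  cw_wt c = if [forall i : 'I_k, c i == 0] then 0%N
            else if [forall i : 'I_k, gam * c i == 0] then soc_wt else gen_wt.
Proof.
have U_gt0 : (0 < q ^ (s - 1) * (q - 1))%N.
  by rewrite muln_gt0 expn_gt0 subn_gt0 (ltnW q_gt1).
case: ifPn => [/forallP c0 | /forallPn cn0].
  rewrite /cw_wt big1 // => g _; rewrite /dot big1 ?/hom_wt ?eqxx // => i _.
  by rewrite (eqP (c0 i)) mul0r.
apply/eqP; rewrite -(eqn_pmul2l U_gt0); apply/eqP.
have := cw_wt_sum c; rewrite sum_rhos_dot; last by apply/existsP.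
case: ifPn => [/forallP gc0 | /forallPn gcn0].
  (* Coefficients in the socle annihilate the ideal, so the sum over [vecs gam_list k] vanishes. *)
  rewrite big_seq big1 ?addn0 => [->|g]; last first.
    move=> /(@dot_eq0 _ gam_list)-> => [|i lt_ik r]; first by rewrite /hom_wt eqxx.
    rewrite mem_gam_list => /existsP[y /eqP->].
    by rewrite mulrCA [c i * _]mulrC (eqP (gc0 (Ordinal lt_ik))) mulr0.
  rewrite mulnA [RHS]mulnAC -!expnD; congr (_ ^ _ * _)%N; lia.
(* Now both sums have the same average, and the weight comes from the difference
   [q ^ (s * k) - q ^ (s * k - k)] of their sizes. *)
rewrite sum_gam_dot; last by apply/existsP.
move=> /(canRL (addnK _))->; rewrite -mulnBl mulnACA -expnD.
have -> : (s - 1 + (s * k - k - 1) = (s * k - k) + (s - 2))%N by lia.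
have -> : ((s - 1) * k = s * k - k)%N by rewrite mulnBl mul1n.
have -> : (q ^ (s * k) - q ^ (s * k - k) = q ^ (s * k - k) * (q ^ k - 1))%N.
  by rewrite mulnBr muln1 -expnD subnK //; lia.
by rewrite expnD mulnACA [((q ^ k - 1) * _)%N]mulnC.
Qed.

Let soc_wt_gt0 : (0 < soc_wt)%N.
Proof. by rewrite expn_gt0 (ltnW q_gt1). Qed.

Let gen_wt_gt0 : (0 < gen_wt)%N.
Proof.
by rewrite muln_gt0 expn_gt0 (ltnW q_gt1) subn_gt0 -[1%N](expn0 q) ltn_exp2l.
Qed.

(** Makes [gen_wt] the least nonzero weight and keeps the two nonzero weight classes apart. *)
Let gen_lt_soc : (gen_wt < soc_wt)%N.
Proof.
have -> : (s * k - 1 = (s * k - k - 1) + k)%N by lia.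
rewrite expnD ltn_pmul2l ?expn_gt0 ?(ltnW q_gt1) //.
by rewrite subn1 ltn_predL expn_gt0 (ltnW q_gt1).
Qed.

Definition codeword (c : seq R) : seq F :=
  gray pi gam e M (map (dot k (nth 0 c)) cols).

Lemma gray_lincomb c : gray pi gam e M (lincomb c (GB gam s e k)) = codeword c.
Proof. by rewrite GB_coord // lincomb_coord_rows. Qed.

Lemma size_codeword c :
  size (codeword c) = (q ^ ((s - 1) * k) * ((q ^ k - 1) %/ (q - 1)))%N.
Proof. by rewrite size_gray size_map size_beta_cols. Qed.

Lemma hamming_wt_codeword c : hamming_wt (codeword c) = cw_wt (nth 0 c).
Proof. exact: hamming_wt_gray. Qed.

Lemma hamming_dist_codeword c c' :
  hamming_dist (codeword c) (codeword c') = cw_wt (fun i => c`_i - c'`_i).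
Proof.
rewrite (hamming_dist_gray pi_surj pi_ker gam_s gam_lt s_gt1 e_bij M_RM).
by apply: eq_bigr => g _; rewrite dotB.
Qed.

Lemma hamming_dist_codeword_ge c c' : size c = k -> size c' = k -> c != c' ->
  (gen_wt <= hamming_dist (codeword c) (codeword c'))%N.
Proof.
move=> sz_c sz_c' neq_cc'; rewrite hamming_dist_codeword cw_wtE.
case: ifPn => [/forallP eq_cc' | _]; last by case: ifP => // _; apply: ltnW.
case/eqP: neq_cc'; apply: (@eq_from_nth _ 0); first by rewrite sz_c.
by rewrite sz_c => i lt_ik; apply/eqP; rewrite -subr_eq0 (eq_cc' (Ordinal lt_ik)).
Qed.

Let coefs := map val (enum {: k.-tuple R}).

Let size_coef c : c \in coefs -> size c = k.
Proof. by case/mapP => t _ ->; rewrite size_tuple. Qed.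

Let coef_mem c : size c = k -> c \in coefs.
Proof.
move/eqP => sz_c; apply/mapP; exists (Tuple sz_c) => //; by rewrite mem_enum.
Qed.

Lemma codeword_inj : {in coefs &, injective codeword}.
Proof.
move=> c c' /size_coef sz_c /size_coef sz_c' eq_cc'; apply/eqP.
apply: contraT => /(hamming_dist_codeword_ge sz_c sz_c').
rewrite eq_cc' leqNgt hamming_dist_codeword cw_wtE ifT ?gen_wt_gt0 //.
by apply/forallP => i; rewrite subrr.
Qed.

(** Injectivity of [codeword] on coefficient vectors passes to [lincomb], so neither [undup] removes
    anything. *)
Lemma codeB_codewords : codeB pi gam e M k = map codeword coefs.
Proof.
have uniq_coefs : uniq coefs by rewrite (map_inj_uniq val_inj) enum_uniq.
have cwE : map codeword coefs =
    map (gray pi gam e M) (map (fun c => lincomb c (GB gam s e k)) coefs).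
  by rewrite -map_comp; apply: eq_map => c; rewrite /= gray_lincomb.
have uniq_cw : uniq (map codeword coefs).
  by rewrite map_inj_in_uniq //; exact: codeword_inj.
rewrite /codeB /SB (@span_tuples _ _ k).
  rewrite (undup_id (s := map _ coefs)) -/coefs; last first.
    by move: uniq_cw; rewrite cwE => /map_uniq.
  by rewrite -cwE undup_id.
by rewrite GB_coord // size_map size_iota.
Qed.

Lemma size_codeB : size (codeB pi gam e M k) = (q ^ (s * k))%N.
Proof.
rewrite codeB_codewords size_map /coefs size_map.
by rewrite -cardE card_tuple card_R expnM.
Qed.

Lemma size_codeB_word w : w \in codeB pi gam e M k ->
  size w = (q ^ ((s - 1) * k) * ((q ^ k - 1) %/ (q - 1)))%N.
Proof. by rewrite codeB_codewords => /mapP[c _ ->]; apply: size_codeword. Qed.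

Lemma min_dist_codeB : min_dist (codeB pi gam e M k) gen_wt.
Proof.
rewrite codeB_codewords; split=> [|_ _ /mapP[c Cc ->] /mapP[c' Cc' ->] neq]; last first.
  apply: hamming_dist_codeword_ge; rewrite ?size_coef //.
  by apply: contraNneq neq => ->.
(* The all-one coefficient vector against zero: the differences are 1, outside the socle because
   [1 < s], so the distance is [gen_wt]. *)
have n1E i : (i < k)%N -> (nseq k 1)`_i - (nseq k 0)`_i = 1 :> R.
  by move=> lt_ik; rewrite !nth_nseq lt_ik subr0.
have dE : hamming_dist (codeword (nseq k 1)) (codeword (nseq k 0)) = gen_wt.
  rewrite hamming_dist_codeword cw_wtE !ifF //; apply/forallP => /(_ (Ordinal k_gt0)).
    by rewrite n1E // mulr1 -[gam]expr1 (negPf (gam_lt s_gt1)).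
  by rewrite n1E // oner_eq0.
have mem_cw x : codeword (nseq k x) \in map codeword coefs.
  by apply: map_f; apply: coef_mem; rewrite size_nseq.
exists (codeword (nseq k 1)), (codeword (nseq k 0)); split=> //.
apply: contraTneq gen_wt_gt0 => eq_cw; rewrite -dE eq_cw hamming_dist_codeword cw_wtE.
by rewrite ifT //; apply/forallP => i; rewrite subrr.
Qed.

(** The coefficient vectors split into zero ([Z]), nonzero with all entries in the socle ([S]
    without [Z]), and the rest. The weight is constant on each class and the three values are
    distinct, so the counts are the class sizes. *)
Lemma count_wt_codeB l :
  count (fun w => hamming_wt w == l) (codeB pi gam e M k) =
    (if l == 0 then 1
     else if l == soc_wt then q ^ k - 1
     else if l == gen_wt then q ^ (s * k) - q ^ k
     else 0)%N.
Proof.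
pose Z := all (pred1 (0 : R)); pose S := all [pred x | gam * x == 0].
have subZS : subpred Z S.
  by move=> c; apply: sub_all => x /eqP->; rewrite /= mulr0.
have countZ : count Z (vecs rhos k) = 1%N.
  rewrite count_all_vecs (permP (perm_rhos gam s e)) count_enum.
  by rewrite card1 exp1n.
have countS : count S (vecs rhos k) = (q ^ k)%N.
  rewrite count_all_vecs (permP (perm_rhos gam s e)) count_enum.
  by rewrite (card_socle pi_surj pi_ker gam_s gam_lt s_gt1 e_bij).
have count_soc : count (predD S Z) (vecs rhos k) = (q ^ k - 1)%N.
  by rewrite count_diff // countS countZ.
have count_gen : count (predC S) (vecs rhos k) = (q ^ (s * k) - q ^ k)%N.
  have := count_predC S (vecs rhos k).
  by rewrite size_vecs size_rhos // -expnM countS => <-; rewrite addKn.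
rewrite codeB_codewords count_map.
have /permP-> := perm_enum_tuple k (perm_rhos gam s e).
have wtE : {in vecs rhos k, forall c, hamming_wt (codeword c) =
    if Z c then 0%N else if S c then soc_wt else gen_wt}.
  move=> c; rewrite mem_vecs => /andP[/eqP sz_c _].
  have allE P : all P c = [forall i : 'I_k, P c`_i].
    apply/(all_nthP 0)/forallP => [cP i | cP i]; first by rewrite cP ?sz_c.
    by rewrite sz_c => lt_ik; apply: (cP (Ordinal lt_ik)).
  by rewrite hamming_wt_codeword cw_wtE /Z /S !allE.
rewrite (eq_in_count (a2 := fun c =>
  (if Z c then 0%N else if S c then soc_wt else gen_wt) == l)); last first.
  by move=> c /wtE /= ->.
case: eqP => [-> | /eqP l_n0].
  rewrite -[RHS]countZ; apply: eq_count => c; case: (Z c) => //=.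
  by case: (S c); rewrite gtn_eqF.
case: eqP => [-> | /eqP l_nsoc].
  rewrite -[RHS]count_soc; apply: eq_count => c /=.
  by case: (Z c) => /=; [rewrite ltn_eqF | case: (S c); rewrite ?eqxx // ltn_eqF].
case: eqP => [-> | /eqP l_ngen].
  rewrite -[RHS]count_gen; apply: eq_count => c /=.
  case Zc: (Z c); first by rewrite subZS //= ltn_eqF.
  by case: (S c); rewrite ?eqxx // gtn_eqF.
rewrite -[RHS](count_pred0 (vecs rhos k)); apply: eq_count => c /=.
by case: (Z c); [|case: (S c)]; apply/negbTE; rewrite eq_sym.
Qed.

End BetaCode.

Theorem theorem3p26 (R : finComNzRingType) (F : finFieldType)
    (pi : {rmorphism R -> F}) (gam : R) (s : nat) (e : 'I_#|F| -> R)
    (M : 'M[F]_(s, #|F| ^ (s - 1))) (k : nat) :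
  chain_ring R ->
  (forall y : F, exists x : R, pi x = y) ->
  (forall x : R, pi x = 0 <-> in_pideal gam x) ->
  gam ^+ s = 0 -> (forall i, (i < s)%N -> gam ^+ i != 0) ->
  (1 < s)%N ->
  bijective (fun i => pi (e i)) ->
  (forall i : 'I_#|F|, val i = 0%N -> e i = 0) ->
  (forall i : 'I_#|F|, val i = 1%N -> e i = 1) ->
  RM1_gen M ->
  (2 <= k)%N ->
  let q := #|F| in
  let C := codeB pi gam e M k in
  let n' := (q ^ ((s - 1) * k) * ((q ^ k - 1) %/ (q - 1)))%N in
  let A := fun l : nat =>
    (if l == 0 then 1
     else if l == q ^ (s * k - 1) then q ^ k - 1
     else if l == q ^ (s * k - k - 1) * (q ^ k - 1) then q ^ (s * k) - q ^ k
     else 0)%N in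
  [/\ all (fun w => size w == n') C,
      size C = (q ^ (s * k))%N,
      min_dist C (q ^ (s * k - k - 1) * (q ^ k - 1))%N
    & forall l : nat, count (fun w => hamming_wt w == l) C = A l].
Proof.
move=> _ pi_surj pi_ker gam_s gam_lt s_gt1 e_bij e0 _ M_RM /ltnW k_gt0 q C n' A.
split.
- by apply/allP => w Cw; apply/eqP; apply: (size_codeB_word (M := M) (e := e)) Cw.
- exact: size_codeB.
- exact: min_dist_codeB.
- exact: count_wt_codeB.
Qed.
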